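(* Let $(z,\Lambda)$ and $(w,\Delta)$ be the pre- and post-change parameters of the dynamic stochastic block model described in the context. Let $\mathcal F=\{f: f:\mathbb N\times\mathbb N\to(0,1)\}$, and for $m\ge1$ let $\mathcal G_m=\{g=((m^2f)\vee1)\wedge 0.5m(m-1): f\in\mathcal F\}$. For $f\in\mathcal F$ let $$\mathcal A(f)=\{(i,j):\ |\lambda_{z(i)z(j)}-\delta_{w(i)w(j)}|>f(m,n)\}$$ be the set of edges whose connection probability changes by more than $f(m,n)$. Suppose that $|\mathcal A(f)|\ge C\,g(m,n)$ for some constant $C>0$ and some $f\in\mathcal F$, $g\in\mathcal G_m$ such that $$n\,m^{-2}\,g(m,n)\,(f(m,n))^2\to\infty .$$ Then $$\frac{n}{m^2\rho_{m,n}}\|\mathrm{Ed}_z(\Lambda)-\mathrm{Ed}_w(\Delta)\|_F^2\to\infty .$$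
   Context: For $K\le m$, a community assignment is an onto map $z:\{1,\dots,m\}\to\{1,\dots,K\}$; for a symmetric $K\times K$ matrix $\Lambda=((\lambda_{uv}))$ with entries in $[0,1]$, $\mathrm{Ed}_z(\Lambda)=((\lambda_{z(i)z(j)}I(i\ne j)))_{m\times m}$ is the edge probability matrix. The dynamic stochastic block model on $m$ nodes over $n$ time points has pre-change parameters $(z,\Lambda)$ and post-change parameters $(w,\Delta)$, where $w$ is another community assignment onto $\{1,\dots,K\}$ and $\Delta=((\delta_{uv}))$ a symmetric $K\times K$ matrix with entries in $[0,1]$: before the change-point, distinct nodes $i,j$ are joined independently with probability $\lambda_{z(i)z(j)}$, and after it with probability $\delta_{w(i)w(j)}$; there are no self-loops, so an edge is a pair $(i,j)$ with $i\neq j$, $1\le i,j\le m$. The parameters $z,w,\Lambda,\Delta$ and $K=K_{m,n}$ may depend on $m,n$, and limits are as $m,n\to\infty$ (with $K_{m,n}\to\infty$). $\rho_{m,n}=\max_{1\le u\le v\le K}\{\lambda_{uv},\delta_{uv}\}$; $\|\cdot\|_F$ is the Frobenius norm; $\vee,\wedge$ denote maximum and minimum. *)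

(* Defs.v *)
(* MathComp / MathComp-Analysis. *)
From HB Require Import structures.
From mathcomp Require Import all_boot all_order all_algebra.
From mathcomp Require Import all_classical all_reals all_analysis.

Set Implicit Arguments.
Unset Strict Implicit.
Unset Printing Implicit Defensive.

Import Order.TTheory GRing.Theory Num.Theory.
Import numFieldNormedType.Exports.

Local Open Scope classical_set_scope.
Local Open Scope ring_scope.

Definition community_assignment (m K : nat) (z : 'I_m -> 'I_K) : Prop :=
  forall u : 'I_K, exists i : 'I_m, z i = u.

Definition connection_matrix (R : realType) (K : nat) (L : 'M[R]_K) : Prop :=
  L \is symmetricmx /\ forall u v : 'I_K, 0 <= L u v <= 1.

(* Edge probability matrix: there are no self-loops, so the diagonal is 0. *)
Definition Ed (R : realType) (m K : nat) (z : 'I_m -> 'I_K) (L : 'M[R]_K) :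
    'M[R]_m :=
  \matrix_(i < m, j < m) (if i != j then L (z i) (z j) else 0).

(* The norm `|A| that MathComp-Analysis puts on matrices is the entrywise
   maximum, so the Frobenius norm is defined here. *)
Definition frobenius_norm (R : realType) (m p : nat) (A : 'M[R]_(m, p)) : R :=
  Num.sqrt (\sum_(i < m) \sum_(j < p) A i j ^+ 2).

(* The default value 0 of the iterated maximum does not affect the result as
   soon as K > 0, because the entries of connection matrices are nonnegative. *)
Definition rho (R : realType) (K : nat) (L D : 'M[R]_K) : R :=
  \big[Num.max/0]_(u < K) \big[Num.max/0]_(v < K | (u <= v)%N)
    Num.max (L u v) (D u v).

(* Edges are ordered pairs of distinct nodes, so at most m(m-1) are changed. *)
Definition changed_edges (R : realType) (m K : nat) (z w : 'I_m -> 'I_K)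
    (L D : 'M[R]_K) (t : R) : {set 'I_m * 'I_m} :=
  [set e : 'I_m * 'I_m | (e.1 != e.2) &&
     (t < `|L (z e.1) (z e.2) - D (w e.1) (w e.2)|)]%SET.

Definition calF (R : realType) : set (nat -> nat -> R) :=
  [set f | forall m n : nat, 0 < f m n < 1].

(* For a fixed number m of nodes, a member of G_m is a function of the number n
   of time points. The function of calF that it comes from is existentially
   quantified, hence unrelated to the threshold used in changed_edges. *)
Definition calG (R : realType) (m : nat) : set (nat -> R) :=
  [set g | exists2 f : nat -> nat -> R, calF f &
     forall n : nat, g n =
       Num.min (Num.max (m%:R ^+ 2 * f m n) 1) (2^-1 * m%:R * (m%:R - 1))].

(* Main.v *)
Require Import Defs.
From HB Require Import structures.
From mathcomp Require Import all_boot all_order all_algebra.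
From mathcomp Require Import all_classical all_reals all_analysis.
From mathcomp Require Import ring.

Set Implicit Arguments.
Unset Strict Implicit.
Unset Printing Implicit Defensive.

Import Order.TTheory GRing.Theory Num.Theory.
Import numFieldNormedType.Exports.

Local Open Scope classical_set_scope.
Local Open Scope ring_scope.

(** Off the diagonal, [Ed z L - Ed w D] has the entries
    [L (z i) (z j) - D (w i) (w j)], so every changed edge contributes more than
    [f m n ^+ 2] to the squared Frobenius norm, which is therefore at least
    [#|changed_edges| * f m n ^+ 2 >= C * g m n * f m n ^+ 2]
    ([card_changed_edges_le_frobenius]).  Since probabilities are at most 1,
    [rho <= 1] ([rho_le1]), and dividing by [rho] only helps: the quantity of
    interest dominates [C * (n * m ^- 2 * g m n * f m n ^+ 2)], which diverges
    ([rate_le_signal]).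

    Dividing by [rho] requires [rho != 0], because division by zero yields 0.
    The diverging rate is eventually positive, which forces [0 < g m n], hence a
    changed edge exists.  Some connection probability then changes by more than
    [f m n > 0] within [[0, rho]], so [rho] is positive
    ([changed_edge_lt_rho]). *)

(** [rho] only ranges over the upper triangle; the symmetry of the matrix
    extends the bound to all entries. *)
Lemma connection_le_rho (R : realType) (K : nat) (L D : 'M[R]_K) :
  connection_matrix L -> connection_matrix D ->
  forall u v : 'I_K, L u v <= rho L D /\ D u v <= rho L D.
Proof.
have symE (M : 'M[R]_K) : connection_matrix M -> forall u v, M u v = M v u.
  case=> + _ u v; rewrite is_hermitianmxE => /eqP {1}->.
  by rewrite expr0 scale1r !mxE.
move=> hL hD.
have upper (u v : 'I_K) : (u <= v)%N -> L u v <= rho L D /\ D u v <= rho L D.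
  move=> le_uv; apply/andP; rewrite -ge_max.
  by apply: (bigmax_sup u) => //; apply: (bigmax_sup v).
move=> u v; case/orP: (leq_total u v) => [/upper//|/upper].
by rewrite (symE L hL) (symE D hD).
Qed.

Lemma rho_le1 (R : realType) (K : nat) (L D : 'M[R]_K) :
  connection_matrix L -> connection_matrix D -> rho L D <= 1.
Proof.
move=> [_ hL] [_ hD]; apply: bigmax_le => // u _; apply: bigmax_le => // v _.
by rewrite ge_max; case/andP: (hL u v) => _ ->; case/andP: (hD u v).
Qed.

(** Both probabilities of a changed edge lie in [[0, rho]], so their distance
    cannot exceed [rho]. *)
Lemma changed_edge_lt_rho (R : realType) (m K : nat) (z w : 'I_m -> 'I_K)
    (L D : 'M[R]_K) (t : R) (e : 'I_m * 'I_m) :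
  connection_matrix L -> connection_matrix D ->
  e \in changed_edges z w L D t -> t < rho L D.
Proof.
move=> hL hD; rewrite inE => /andP[_ /lt_le_trans]; apply.
have [L_le _] := connection_le_rho hL hD (z e.1) (z e.2).
have [_ D_le] := connection_le_rho hL hD (w e.1) (w e.2).
have /andP[L_ge0 _] := hL.2 (z e.1) (z e.2).
have /andP[D_ge0 _] := hD.2 (w e.1) (w e.2).
rewrite ler_norml; apply/andP; split.
  by rewrite lerBrDl (le_trans _ L_ge0)// subr_le0.
by rewrite lerBlDr (le_trans L_le)// lerDl.
Qed.

Lemma sqr_frobenius_norm (R : realType) (m p : nat) (A : 'M[R]_(m, p)) :
  frobenius_norm A ^+ 2 = \sum_(e : 'I_m * 'I_p) A e.1 e.2 ^+ 2.
Proof.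
rewrite /frobenius_norm pair_bigA sqr_sqrtr//.
by apply: sumr_ge0 => e _; exact: sqr_ge0.
Qed.

(** A Chebyshev-type bound: the sum of squares is restricted to the changed
    edges, on each of which the summand is at least [t ^+ 2]. *)
Lemma card_changed_edges_le_frobenius (R : realType) (m K : nat)
    (z w : 'I_m -> 'I_K) (L D : 'M[R]_K) (t : R) : 0 <= t ->
  #|changed_edges z w L D t|%:R * t ^+ 2 <= frobenius_norm (Ed z L - Ed w D) ^+ 2.
Proof.
move=> t_ge0; rewrite sqr_frobenius_norm mulr_natl -sumr_const.
rewrite [leRHS](bigID (mem (changed_edges z w L D t)))/= -[leLHS]addr0.
apply: lerD; last by apply: sumr_ge0 => e _; exact: sqr_ge0.
apply: ler_sum => e; rewrite inE => /andP[e12 lt_t].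
by rewrite !mxE e12 -[leRHS]real_normK ?num_real// lerXn2r ?nnegrE// ltW.
Qed.

(** The comparison at fixed numbers of nodes and time points.  Positivity of
    the rate excludes [rho = 0]. *)
Lemma rate_le_signal (R : realType) (m n K : nat) (z w : 'I_m -> 'I_K)
    (L D : 'M[R]_K) (t G C : R) :
  connection_matrix L -> connection_matrix D -> 0 < t -> 0 < C ->
  C * G <= #|changed_edges z w L D t|%:R ->
  0 < n%:R * m%:R ^- 2 * G * t ^+ 2 ->
  C * (n%:R * m%:R ^- 2 * G * t ^+ 2) <=
    n%:R / (m%:R ^+ 2 * rho L D) * frobenius_norm (Ed z L - Ed w D) ^+ 2.
Proof.
move=> hL hD t_gt0 hC card_ge rate_gt0.
have nm_ge0 : 0 <= n%:R * m%:R ^- 2 :> R.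
  by rewrite mulr_ge0// invr_ge0 exprn_ge0.
have G_gt0 : 0 < G.
  rewrite ltNge; apply/negP => G_le0; move: rate_gt0.
  by rewrite ltNge mulr_le0_ge0 ?sqr_ge0// mulr_ge0_le0.
have rho_gt0 : 0 < rho L D.
  have : (0 < #|changed_edges z w L D t|)%N.
    by rewrite -(ltr0n R) (lt_le_trans _ card_ge)// mulr_gt0.
  by case/card_gt0P => e /(changed_edge_lt_rho hL hD) /(lt_trans t_gt0).
set F := frobenius_norm _ ^+ 2.
have CgfF : C * G * t ^+ 2 <= F.
  apply: le_trans (card_changed_edges_le_frobenius z w L D (ltW t_gt0)).
  by rewrite ler_wpM2r ?sqr_ge0.
have rateE : C * (n%:R * m%:R ^- 2 * G * t ^+ 2) =
    n%:R * m%:R ^- 2 * (C * G * t ^+ 2) by ring.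
have signalE : n%:R / (m%:R ^+ 2 * rho L D) * F =
    n%:R * m%:R ^- 2 * ((rho L D)^-1 * F) by rewrite invfM !mulrA.
rewrite rateE signalE ler_wpM2l// (le_trans CgfF)//.
by rewrite ler_peMl ?sqr_ge0// invf_ge1// rho_le1.
Qed.

Theorem proposition24 (R : realType)
  (K : nat -> nat -> nat)
  (z w : forall m n : nat, 'I_m -> 'I_(K m n))
  (Lambda Delta : forall m n : nat, 'M[R]_(K m n))
  (hKm : forall m n : nat, (K m n <= m)%N)
  (hz : forall m n : nat, community_assignment (z m n))
  (hw : forall m n : nat, community_assignment (w m n))
  (hLambda : forall m n : nat, connection_matrix (Lambda m n))
  (hDelta : forall m n : nat, connection_matrix (Delta m n))
  (hK : K p.1 p.2 @[p --> (\oo, \oo)] --> \oo)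
  (f g : nat -> nat -> R) (C : R)
  (hf : calF f)
  (hg : forall m : nat, (1 <= m)%N -> calG m (g m))
  (hC : 0 < C)
  (hA : \forall p \near (\oo, \oo),
     C * g p.1 p.2 <=
       #|changed_edges (z p.1 p.2) (w p.1 p.2) (Lambda p.1 p.2)
           (Delta p.1 p.2) (f p.1 p.2)|%:R)
  (hrate : p.2%:R * p.1%:R ^- 2 * g p.1 p.2 * f p.1 p.2 ^+ 2
     @[p --> (\oo, \oo)] --> +oo) :
  p.2%:R / (p.1%:R ^+ 2 * rho (Lambda p.1 p.2) (Delta p.1 p.2)) *
    frobenius_norm (Ed (z p.1 p.2) (Lambda p.1 p.2)
                    - Ed (w p.1 p.2) (Delta p.1 p.2)) ^+ 2
    @[p --> (\oo, \oo)] --> +oo.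
Proof.
(* Makes the product filter available to instance search. *)
have FF : Filter (nbhs ((\oo, \oo) : set_system nat * set_system nat)).
  exact: filter_prod_filter.
apply/cvgryPge => A.
have rate_ge := cvgry_ge hrate (A / C).
have rate_gt0 := cvgry_gt hrate 0.
near=> p.
have /andP[f_gt0 _] := hf p.1 p.2.
apply: le_trans (rate_le_signal (G := g p.1 p.2) _ _ f_gt0 hC _ _) => //.
- by rewrite mulrC -ler_pdivrMr//; near: p; exact: rate_ge.
- by near: p; exact: hA.
- by near: p; exact: rate_gt0.
Unshelve.
all: by end_near.
Qed.
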